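(* Let $M$ be a matching in a finite simple graph $\Gamma$. For a set $N$ of edges, let $\Gamma[N]$ denote the subgraph of $\Gamma$ induced by the set of all endpoints of edges in $N$. The following conditions are equivalent: (i) $M$ is a positive matching of $\Gamma$; (ii) $\Gamma[M]$ does not contain any alternating closed walk with respect to $M$; (iii) for every non-empty subset $N\subseteq M$, the graph $\Gamma[N]$ contains a pendant edge belonging to $M$; (iv) there exists an ordering $M=\{e_1,\ldots,e_n\}$ of the edges of $M$ such that $e_i$ is a pendant edge in $\Gamma[\{e_1,\ldots,e_i\}]$, for $i=1,\ldots,n$.
   Context: A matching in a graph is a set of pairwise disjoint edges. A matching $M$ of a graph $\Gamma=(V,E)$ is positive if there is a weight function $w\colon V\to\mathbb{R}$ such that $w(u)+w(v)>0$ for every edge $uv\in M$ and $w(u)+w(v)<0$ for every edge $uv\in E\setminus M$. An alternating closed walk with respect to $M$ is a closed walk (of positive length, vertices and edges may repeat) whose edges alternate, cyclically, between edges of $M$ and edges of $M^c:=E(\Gamma)\setminus M$; thus it has an even number of edges and its last and first edges also alternate. A vertex is pendant if it has valency (degree) one; an edge is pendant if at least one of its end vertices is a pendant vertex. *)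

(* Defs.v *)
From mathcomp Require Import all_boot all_order all_algebra.
From mathcomp Require Import reals.

Set Implicit Arguments.
Unset Strict Implicit.
Unset Printing Implicit Defensive.

Import Order.TTheory GRing.Theory Num.Theory.

(** An edge is a two-element set of vertices. The vertices form a subset of an
    ambient finite type, so that a graph, its induced subgraphs and their edge
    sets all live over the same type. *)
Record sgraph (T : finType) := SGraph {
  vertices : {set T};
  edges : {set {set T}};
  edgesP : forall a, a \in edges -> (a \subset vertices) && (#|a| == 2)
}.

Section Graph.
Variable T : finType.
Implicit Types (G : sgraph T) (S : {set T}) (M N : {set {set T}}).

Lemma induced_edgesP G S a :
  a \in [set b in edges G | b \subset S] ->
  (a \subset vertices G :&: S) && (#|a| == 2).
Proof.
by rewrite inE subsetI => /andP[/edgesP/andP[-> ->] ->].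
Qed.

Definition induced G S : sgraph T := SGraph (@induced_edgesP G S).

(** [Γ[N]]: [cover N] is the set of all endpoints of edges in [N]. *)
Definition edge_induced G N : sgraph T := induced G (cover N).

Definition matching G M : bool := (M \subset edges G) && trivIset M.

(** Only the values of [w] on [vertices G] matter. *)
Definition positive_matching (R : realType) G M : Prop :=
  matching G M /\
  exists w : T -> R,
    (forall u v, [set u; v] \in M -> (0 < w u + w v)%R) /\
    (forall u v, [set u; v] \in edges G :\: M -> (w u + w v < 0)%R).

(** The sequence [:: v_0; ...; v_(k-1)] encodes the closed walk
    v_0, v_1, ..., v_(k-1), v_0, which has k edges. *)
Definition closed_walk G (c : seq T) : bool :=
  (c != [::]) && cycle (fun u v => [set u; v] \in edges G) c.

Definition walk_edges (c : seq T) : seq {set T} :=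
  [seq [set p.1; p.2] | p <- zip c (rot 1 c)].

Definition alternates G M : rel {set T} := fun a b =>
  ((a \in M) && (b \in edges G :\: M)) || ((a \in edges G :\: M) && (b \in M)).

(** The cyclic condition includes the pair (last edge, first edge), and so it
    forces an even number of edges. *)
Definition alternating G M (c : seq T) : bool :=
  cycle (alternates G M) (walk_edges c).

Definition degree G (v : T) : nat := #|[set a in edges G | v \in a]|.

Definition pendant_vertex G (v : T) : bool :=
  (v \in vertices G) && (degree G v == 1).

Definition pendant_edge G (a : {set T}) : bool :=
  (a \in edges G) && [exists v in a, pendant_vertex G v].

End Graph.

(* Main.v *)
Require Import Defs.
From mathcomp Require Import all_boot all_order all_algebra.
From mathcomp Require Import reals.

(** The four conditions are proved equivalent in a cycle of implications.

    Positive implies no alternating closed walk: let an alternating closed walk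
    have arcs (x, y), and give an arc the potential [w y] if its edge is in [M]
    and [- w y] otherwise. Alternation and the sign conditions on [w] make the
    potential increase strictly from each arc to the next, which is absurd
    around a cycle ([positive_no_alternating_walk]).

    No alternating closed walk implies pendant edges: if no edge of [N] is
    pendant in [Γ[N]], each endpoint of [N] has a neighbour along an edge of
    [M] and another one along an edge outside [M], both endpoints of [N].
    Following the two kinds of edges in turn, one must eventually come back to
    a position already visited, in the same phase, and the part in between is
    an alternating closed walk ([alternating_walk_exists]).

    Pendant edges imply a pendant ordering: take as last edge a pendant edge of
    [Γ[M]], remove it, and continue with the remaining edges
    ([pendant_order_exists]).

    A pendant ordering implies positive: count the stages from [0] and let [n]
    be the size of [M]. An endpoint of the [i]-th edge gets the weight [2i + 2]
    if it is pendant at stage [i] and [-(2i + 1)] otherwise; a vertex outside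
    [cover M] gets [-(2n + 1)], as if it came last. An edge of [M] has at least
    one pendant endpoint, hence positive weight. For an edge outside [M], an
    endpoint of positive weight comes strictly before the other one: otherwise
    it would lie, at its own stage, both on this edge and on its edge of [M].
    The absolute values increase with the stage, so the later endpoint, which
    is negative, decides the sign
    ([pendant_order_positive]). *)

Set Implicit Arguments.
Unset Strict Implicit.
Unset Printing Implicit Defensive.

Import Order.TTheory GRing.Theory Num.Theory.

(** * Cyclic sequences *)

(** Iterating [f] from [x], some value [y] must come back; the values from [y]
    up to its return form the cycle. *)
Lemma periodic_orbit (S : finType) (f : S -> S) (P : pred S) (x : S) :
    P x -> (forall y, P y -> P (f y)) ->
  exists p, [/\ p != [::], fcycle f p & all P p].
Proof.
move=> Px Pf; have Piter n : P (iter n f x) by elim: n => //= n /Pf.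
have /trajectP[i ltin] := looping_order f x.
rewrite -(subnK (ltnW ltin)) iterD; set y := iter i f x => eqy.
have [m def_m] : exists m, order f x - i = m.+1.
  by exists (order f x - i).-1; rewrite prednK // subn_gt0.
exists (traject f y m.+1); split=> //.
  have fy : iter m f (f y) = y by rewrite -iterSr -def_m.
  by rewrite /= -{3}fy -trajectSr fpath_traject.
apply/allP=> z /trajectP[k _ ->]; rewrite /y -iterD; exact: Piter.
Qed.

Section Walks.
Variable T : finType.
Implicit Type c : seq T.

Definition arcs c : seq (T * T) := zip c (rot 1 c).

Lemma arcs_chain c : cycle (fun d d' : T * T => d.2 == d'.1) (arcs c).
Proof.
case: c => [|x c] //; rewrite /arcs rot1_cons (cycle_path (x, x)).
have -> : last (x, x) (zip (x :: c) (rcons c x)) = (last x c, x).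
  by rewrite (lastI x c) zip_rcons ?last_rcons // size_belast.
move: (last x c) => y; elim: c x {3}x y => [|z c IHc] x t y /=.
  by rewrite eqxx.
by rewrite eqxx IHc.
Qed.

(** A walk may visit a vertex several times, so it is followed through states
    in [S] from which the next step can be computed. *)
Lemma walk_edges_fcycle (S : eqType) (f : S -> S) (v : S -> T) (p : seq S) :
  fcycle f p -> walk_edges (map v p) = [seq [set v x; v (f x)] | x <- p].
Proof.
move=> fp; have -> : [seq [set v x; v (f x)] | x <- p]
    = [seq [set d.1; d.2] | d <- zip (map v p) (map v (map f p))].
  by elim: p {fp} => //= x p ->.
rewrite /walk_edges -map_rot; congr (map _ (zip _ (map v _))).
case: p fp => // x p; rewrite rot1_cons /=.
by elim: p x {2 3}x => [|z p IHp] x t /= /andP[/eqP-> //] /IHp->.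
Qed.

End Walks.

(** * Edges of a matching *)

Section PositiveMatchings.
Variables (T : finType) (G : sgraph T) (M : {set {set T}}).
Hypothesis hM : matching G M.
Implicit Types (a b : {set T}) (N : {set {set T}}) (s : seq {set T}).

Lemma matching_edge a : a \in M -> a \in edges G.
Proof. by case/andP: hM => /subsetP/(_ a). Qed.

Lemma matching_inj a b v : a \in M -> b \in M -> v \in a -> v \in b -> a = b.
Proof.
case/andP: hM => _ /trivIsetP trM aM bM va vb.
by apply: contraTeq va => /(trM _ _ aM bM)/disjointFl->.
Qed.

Lemma edge_other_end a v :
  a \in edges G -> v \in a -> exists2 u, u \in a & a = [set v; u].
Proof.
move=> /edgesP/andP[_ /cards2P[x [y [_ ->]]]]; rewrite !inE.
by case/orP=> /eqP->; [exists y | exists x; last rewrite setUC];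
  rewrite ?inE ?eqxx ?orbT.
Qed.

Lemma edge_induced_edge N a :
  (a \in edges (edge_induced G N)) = (a \in edges G) && (a \subset cover N).
Proof. by rewrite inE. Qed.

Lemma sub_cover N a : a \in N -> a \subset cover N.
Proof. exact: bigcup_sup. Qed.

(** * Positive matchings have no alternating closed walk *)

(** On an arc [(x, y)], the potential is [w y] or [- w y]. If the next arc is
    [(y, z)], the sign of [w y + w z] compares the two potentials, and it is
    always the second one that is larger. A strict order has no cycle. *)
Lemma positive_no_alternating_walk (R : realType) (c : seq T) :
  positive_matching R G M -> c != [::] -> ~ alternating G M c.
Proof.
move=> [_ [w [wpos wneg]]] c0 alt.
pose e (d : T * T) := [set d.1; d.2].
pose q d : R := (if e d \in M then w d.2 else - w d.2)%R.
have : cycle <%R (map q (arcs c)).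
  rewrite cycle_map; have := arcs_chain c.
  have {alt} : cycle (relpre e (alternates G M)) (arcs c).
    by move: alt; rewrite /alternating cycle_map.
  move=> alt chain; move: (conj alt chain) => /andP; rewrite -cycle_relI.
  apply: sub_cycle => -[x y] [y' z] /= /andP[+ /eqP eqy]; rewrite -{}eqy.
  rewrite /q /e /alternates /= => /orP[]/andP[].
  - move=> -> yzE; have := yzE; rewrite inE => /andP[/negPf-> _].
    by rewrite -subr_lt0 opprK wneg.
  - rewrite inE => /andP[/negPf-> _] yzM; rewrite yzM.
    by rewrite -subr_gt0 opprK addrC wpos.
rewrite (cycle_all2rel lt_trans).
by case: c c0 {alt} => // x [|y c] _; rewrite /arcs rot1_cons /allrel /= ltxx.
Qed.

(** * Without alternating closed walk there are pendant edges *)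

(** The walk is read off an orbit of the map that moves along an edge of [M]
    and along an edge outside [M] in turn; its states are the vertices of [S]
    with the kind of the next edge. *)
Lemma alternating_walk_exists (S : {set T}) :
    S \subset cover M -> S != set0 ->
    (forall v, v \in S -> exists2 u, u \in S & [set v; u] \in M) ->
    (forall v, v \in S -> exists2 u, u \in S & [set v; u] \in edges G :\: M) ->
  exists c, closed_walk (edge_induced G M) c /\ alternating G M c.
Proof.
move=> subS /set0Pn[v0 v0S] stepM stepE.
pose Q (b : bool) v u :=
  (u \in S) && ([set v; u] \in if b then M else edges G :\: M).
pose nxt (b : bool) v := odflt v [pick u | Q b v u].
have nxtP (b : bool) v : v \in S -> Q b v (nxt b v).
  move=> vS; rewrite /nxt; case: pickP => //= noQ.
  have [u uS uvb] : exists2 u, u \in S &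
      [set v; u] \in if b then M else edges G :\: M.
    by case: b {noQ}; [apply: stepM | apply: stepE].
  by have := noQ u; rewrite /Q uS uvb.
pose h (x : T * bool) := (nxt x.2 x.1, ~~ x.2).
have [x xS|p [p0 hp pS]] := @periodic_orbit _ h (fun x => x.1 \in S)
  (v0, true) v0S; first by case/andP: (nxtP x.2 _ xS).
exists (map fst p); split.
  apply/andP; split; first by case: (p) p0.
  rewrite cycle_map; apply: (sub_in_cycle _ pS hp) => x y xS yS /eqP eqy.
  have /andP[_] := nxtP x.2 _ xS; rewrite /= inE -eqy /= => xyM.
  apply/andP; split.
    by case: x.2 xyM => [/matching_edge //|]; rewrite inE => /andP[].
  apply: subset_trans subS; apply/subsetP=> z; rewrite !inE.
  by case/orP=> /eqP-> //; case/andP: (nxtP x.2 _ xS).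
rewrite /alternating (walk_edges_fcycle _ hp) cycle_map.
apply: (sub_in_cycle _ pS hp) => x y xS + /eqP eqy; rewrite -{}eqy => hxS.
have /andP[_] := nxtP x.2 _ xS; have /andP[_] := nxtP (h x).2 _ hxS.
rewrite /= /alternates.
by case: x.2 => /= -> ->; rewrite ?orbT.
Qed.

Lemma degree_ge2 (H : sgraph T) a b v :
  a \in edges H -> b \in edges H -> v \in a -> v \in b -> a != b ->
  1 < degree H v.
Proof.
move=> aH bH va vb neq_ab.
apply: (@leq_trans #|[set a; b]|); first by rewrite cards2 neq_ab.
apply: subset_leq_card.
by apply/subsetP=> d; rewrite !inE => /orP[]/eqP->; rewrite ?aH ?bH.
Qed.

Lemma degree_neq1 (H : sgraph T) a v :
  a \in edges H -> v \in a -> degree H v != 1 ->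
  exists b, [/\ b \in edges H, v \in b & b != a].
Proof.
move=> aH va; rewrite /degree (cardsD1 a) inE aH va /=.
rewrite -[1]addn0 eqn_add2l cards_eq0 => /set0Pn[b].
by rewrite !inE => /and3P[ba bH vb]; exists b.
Qed.

Lemma pendant_edge_of_no_walk N :
    ~ (exists c, closed_walk (edge_induced G M) c /\ alternating G M c) ->
    N != set0 -> N \subset M ->
  exists a, a \in M /\ pendant_edge (edge_induced G N) a.
Proof.
move=> noW N0 sNM.
have [/exists_inP[a aM pa]|/exists_inPn nopen] :=
  boolP [exists a in M, pendant_edge (edge_induced G N) a]; first by exists a.
have NM a : a \in N -> a \in M by move/(subsetP sNM).
have NE a : a \in N -> a \in edges (edge_induced G N).
  by move=> aN; rewrite edge_induced_edge matching_edge ?sub_cover // NM.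
case: noW; apply: (alternating_walk_exists (S := cover N)).
- by apply/bigcupsP=> a /NM/sub_cover.
- case/set0Pn: N0 => a aN; have := edgesP (NE a aN) => /andP[_].
  case/cards2P=> x [y [_ eqa]]; apply/set0Pn; exists x.
  by apply/bigcupP; exists a; rewrite // eqa !inE eqxx.
- move=> v /bigcupP[a aN va].
  have [u ua eqa] := edge_other_end (matching_edge (NM _ aN)) va.
  by exists u; rewrite -?eqa ?NM //; apply/bigcupP; exists a.
- move=> v /bigcupP[a aN va]; have := nopen a (NM _ aN).
  rewrite /pendant_edge NE //= => /exists_inPn/(_ v va).
  rewrite /pendant_vertex /= inE.
  have vN : v \in cover N by apply/bigcupP; exists a.
  have vG : v \in vertices G.
    by have /edgesP/andP[/subsetP->] := matching_edge (NM _ aN).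
  rewrite vN vG => /(degree_neq1 (NE _ aN) va)[b [bN vb neq_ba]].
  move: bN; rewrite edge_induced_edge => /andP[bG /subsetP bN].
  have [u ub eqb] := edge_other_end bG vb.
  exists u; first exact: bN.
  rewrite -eqb inE bG andbT; apply: contra neq_ba => bM.
  by rewrite (matching_inj bM (NM _ aN) vb va).
Qed.

(** * Pendant orderings *)

Definition pendant_order s :=
  forall i, i < size s ->
    pendant_edge (edge_induced G [set:: take i.+1 s]) (nth set0 s i).

(** The last edge is chosen first. Its own condition involves only the set [N]
    of all the edges, and the conditions on the other edges do not involve
    it, so a pendant ordering of the others can be extended by it. *)
Lemma pendant_order_exists N :
    (forall N, N != set0 -> N \subset M ->
       exists a, a \in M /\ pendant_edge (edge_induced G N) a) ->
    N \subset M ->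
  exists s, [/\ uniq s, [set:: s] = N & pendant_order s].
Proof.
move=> penM; move def_n: #|N| => n; elim: n N def_n => [|n IHn] N cardN sNM.
  exists [::]; split=> //; rewrite (cards0_eq cardN).
  by apply/setP=> a; rewrite !inE.
have N0 : N != set0 by rewrite -card_gt0 cardN.
have [a [aM pa]] := penM N N0 sNM.
have aN : a \in N.
  have /andP[+ _] := pa; rewrite edge_induced_edge => /andP[/edgesP/andP[_]].
  case/cards2P=> x [y [_ eqa]] /subsetP/(_ x).
  have xa : x \in a by rewrite eqa !inE eqxx.
  by case/(_ xa)/bigcupP=> b bN /(matching_inj aM (subsetP sNM _ bN) xa)->.
have [||s [us defs ps]] := IHn (N :\ a).
- by move: cardN; rewrite (cardsD1 a) aN => -[].
- exact: subset_trans (subD1set _ _) sNM.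
have in_s b : (b \in s) = (b != a) && (b \in N).
  by have /setP/(_ b) := defs; rewrite !inE.
have defN : [set:: rcons s a] = N.
  apply/setP=> b; rewrite inE mem_rcons in_cons in_s.
  by case: eqP => [->|].
exists (rcons s a); split=> // [|i]; first by rewrite rcons_uniq us in_s eqxx.
rewrite size_rcons ltnS leq_eqVlt nth_rcons => /predU1P[->|lti].
  by rewrite ltnn eqxx take_oversize ?defN // size_rcons.
by rewrite lti -cats1 takel_cat //; apply: ps.
Qed.

(** * A pendant ordering gives weights *)

Section Weights.
Variable s : seq {set T}.
Hypotheses (uniq_s : uniq s) (def_s : [set:: s] = M).
Hypothesis order_s : pendant_order s.

(** A vertex outside [cover M] has rank [size s], after all the others. *)
Definition rank v := find (fun a => v \in a) s.

(** At rank [size s] this is false, as [v] is then not a vertex of the induced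
    graph. *)
Definition leaf v :=
  pendant_vertex (edge_induced G [set:: take (rank v).+1 s]) v.

Definition weight (R : realType) v : R :=
  (if leaf v then (rank v).*2.+2%:R else - (rank v).*2.+1%:R)%R.

Lemma mem_order a : (a \in s) = (a \in M).
Proof. by rewrite -def_s inE. Qed.

Lemma rank_edge v :
  rank v < size s -> nth set0 s (rank v) \in M /\ v \in nth set0 s (rank v).
Proof.
move=> lti; rewrite -mem_order mem_nth //; split=> //.
by have := @nth_find _ set0 (fun a => v \in a) s; rewrite has_find; apply.
Qed.

Lemma rank_in_edge a v : a \in M -> v \in a -> nth set0 s (rank v) = a.
Proof.
move=> aM va; have lti : rank v < size s.
  by rewrite -has_find; apply/hasP; exists a; rewrite ?mem_order.
by have [eM ve] := rank_edge lti; apply: matching_inj eM aM ve va.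
Qed.

Lemma leaf_rank v : leaf v -> rank v < size s.
Proof.
case/andP; rewrite inE => /andP[_ /bigcupP[a + va] _].
rewrite inE => /mem_take sa; rewrite -has_find.
by apply/hasP; exists a.
Qed.

(** If [u] were present when the edge through [v] arrives, [v] would lie on two
    edges at that stage: its edge of [M] and [[set u; v]]. *)
Lemma leaf_rank_lt u v :
  leaf v -> [set u; v] \in edges G :\: M -> rank v < rank u.
Proof.
move=> lv; rewrite inE ltnNge => /andP[uvM uvG].
apply/negP=> le_uv; have ltv := leaf_rank lv.
have cov x : rank x <= rank v ->
    exists2 a, a \in [set:: take (rank v).+1 s] & (a \in M) && (x \in a).
  move=> lex; have [aM xa] := rank_edge (leq_ltn_trans lex ltv).
  exists (nth set0 s (rank x)); last by rewrite aM.
  rewrite inE -(nth_take set0 (n0 := (rank v).+1)) //.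
  by apply: mem_nth; rewrite size_takel.
have [a atk /andP[aM va]] := cov v (leqnn _).
case/andP: lv => _ /eqP deg1.
have := @degree_ge2 (edge_induced G [set:: take (rank v).+1 s]) a [set u; v] v.
rewrite deg1 => /(_ _ _ va); rewrite !edge_induced_edge => noedge.
have : 1 < 1; last by [].
apply: noedge; rewrite ?set22 //.
- by rewrite matching_edge // sub_cover.
- rewrite uvG; apply/subsetP=> x; rewrite in_set2 => eqx.
  have {eqx} /cov[b btk /andP[_ xb]] : rank x <= rank v.
    by case/orP: eqx => /eqP->.
  by apply/bigcupP; exists b.
- by apply: contraNneq uvM => <-.
Qed.

Lemma weight_matching (R : realType) u v :
  [set u; v] \in M -> (0 < weight R u + weight R v)%R.
Proof.
move=> uvM.
have ru := rank_in_edge (v := u) uvM (set21 _ _).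
have rv := rank_in_edge (v := v) uvM (set22 _ _).
have lt_rank x : nth set0 s (rank x) = [set u; v] -> rank x < size s.
  move=> rx; rewrite ltnNge; apply/negP=> /(nth_default set0).
  by rewrite rx => /setP/(_ u); rewrite !inE eqxx.
have eq_uv : rank u = rank v.
  by apply/eqP; rewrite -(nth_uniq set0 _ _ uniq_s) ?lt_rank // ru rv.
have : leaf u || leaf v.
  have /andP[_ /exists_inP[x]] := order_s (lt_rank u ru).
  by rewrite ru !inE /leaf => /orP[]/eqP-> px; rewrite -?eq_uv px ?orbT.
rewrite /weight eq_uv; case: (leaf u) (leaf v) => -[] // _.
- by rewrite -natrD ltr0n.
- by rewrite subr_gt0 ltr_nat.
- by rewrite addrC subr_gt0 ltr_nat.
Qed.

Lemma weight_nonmatching (R : realType) u v :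
  [set u; v] \in edges G :\: M -> (weight R u + weight R v < 0)%R.
Proof.
move=> uvE; have vuE : [set v; u] \in edges G :\: M by rewrite setUC.
rewrite /weight; have := leaf_rank_lt (u := v) (v := u); rewrite vuE.
have := leaf_rank_lt (u := u) (v := v); rewrite uvE.
case: (leaf u) (leaf v) => -[].
- by move=> /(_ isT isT)/ltnW; rewrite leqNgt => /negPf-> /(_ isT isT).
- move=> _ /(_ isT isT) lt_uv; rewrite subr_lt0 ltr_nat.
  by rewrite !ltnS -doubleS leq_double.
- move=> /(_ isT isT) lt_vu _; rewrite addrC subr_lt0 ltr_nat.
  by rewrite !ltnS -doubleS leq_double.
- by move=> _ _; rewrite -opprD -natrD oppr_lt0 ltr0n.
Qed.

Lemma pendant_order_positive (R : realType) : positive_matching R G M.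
Proof.
split=> //; exists (weight R).
by split=> u v; [apply: weight_matching | apply: weight_nonmatching].
Qed.

End Weights.

End PositiveMatchings.

(** * The equivalence *)

Theorem theorem2p1 (R : realType) (T : finType) (G : sgraph T)
    (M : {set {set T}}) (hM : matching G M) :
  [<-> positive_matching R G M;
       ~ (exists c : seq T,
            closed_walk (edge_induced G M) c /\ alternating G M c);
       forall N : {set {set T}}, N != set0 -> N \subset M ->
         exists a : {set T}, a \in M /\ pendant_edge (edge_induced G N) a;
       exists s : seq {set T},
         [/\ uniq s, [set:: s] = M &
             forall i : nat, i < size s ->
               pendant_edge (edge_induced G [set:: take i.+1 s])
                 (nth set0 s i)]].
Proof.
tfae.
- move=> posM [c [/andP[c0 _]]]; exact: positive_no_alternating_walk posM c0.
- by move=> noW N; apply: pendant_edge_of_no_walk.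
- by move=> penM; apply: (pendant_order_exists hM penM).
- by case=> s [us ds os]; apply: pendant_order_positive us ds os R.
Qed.
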